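(* Let $\omega_0=W(1)$. The following three identities hold for positive integers $n$: $$\frac{1}{(1+\omega_0)^{n-1}}\sum_{k=0}^{n-1}\left\langle\!\!\left\langle{n-1\atop k}\right\rangle\!\!\right\rangle(-1)^k\omega_0^k=\sum_{k=0}^{n-1}\frac{(-1)^{n+k-1}\,d(n+k-1,k)}{(1+\omega_0)^k},$$ $$\frac{1}{(1+\omega_0)^{n-1}}\sum_{k=0}^{n-1}\left\langle\!\!\left\langle{n-1\atop k}\right\rangle\!\!\right\rangle(-1)^{k+1}\omega_0^{k+1}=\sum_{k=0}^{n-1}\genfrac{\{}{\}}{0pt}{}{n+k-1}{k}_{\ge 2}\frac{(-1)^k\omega_0^k}{(1+\omega_0)^k},$$ $$\omega_0\sum_{k=0}^{n-1}\frac{(-1)^{n+k}\,d(n+k-1,k)}{(1+\omega_0)^k}=\sum_{k=0}^{n-1}\genfrac{\{}{\}}{0pt}{}{n+k-1}{k}_{\ge 2}\frac{(-1)^k\omega_0^k}{(1+\omega_0)^k}.$$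
   Context: $W$ is the principal branch of the Lambert $W$ function, so $\omega_0=W(1)=0.56714329\ldots$ is the Omega constant. $\genfrac{\{}{\}}{0pt}{}{n}{k}_{\ge 2}$ is the 2-associated Stirling number of the second kind (Stirling subset number): the number of partitions of an $n$-element set into $k$ blocks each of size at least $2$ (with value $1$ for $n=k=0$). $d(m,k)$ are the unsigned associated Stirling numbers of the first kind, given by $[\ln(1+v)-v]^k=k!\sum_{m=2k}^\infty(-1)^{m+k}d(m,k)\frac{v^m}{m!}$ (with $d(m,k)=0$ for $0\le m<2k$). $\left\langle\!\left\langle{n\atop k}\right\rangle\!\right\rangle$ are the second-order Eulerian numbers: $\left\langle\!\left\langle{0\atop 0}\right\rangle\!\right\rangle=1$, $\left\langle\!\left\langle{0\atop k}\right\rangle\!\right\rangle=0$ for $k\ne0$, and $\left\langle\!\left\langle{n\atop k}\right\rangle\!\right\rangle=(k+1)\left\langle\!\left\langle{n-1\atop k}\right\rangle\!\right\rangle+(2n-1-k)\left\langle\!\left\langle{n-1\atop k-1}\right\rangle\!\right\rangle$ for $n\ge1$.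
   Formalization: The second and third identities are proved for n ≥ 2 only, because at n = 1 they are false (left sides equal −ω₀, right sides equal 1); the first identity is proved for all positive n as stated. *)

(* Defs.v *)
From mathcomp Require Import all_boot all_order all_algebra.
From mathcomp Require Import all_classical all_reals all_analysis.

Set Implicit Arguments.
Unset Strict Implicit.
Unset Printing Implicit Defensive.

Import Order.TTheory GRing.Theory Num.Theory.
Import numFieldNormedType.Exports.

Local Open Scope classical_set_scope.
Local Open Scope ring_scope.

(* Principal branch of the Lambert W function on the real line: for
   x >= - expR (-1) it is the unique w >= -1 with w * expR w = x (for
   smaller x there is no real solution and the value is the dummy 0). *)
Definition lambertW0 (R : realType) (x : R) : R :=
  xget 0 [set w : R | -1 <= w /\ w * expR w = x].

Definition omega0 (R : realType) : R := lambertW0 (1 : R).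

(* Number of partitions of an n-element set into k blocks of size >= 2.
   The blocks of a finset partition are nonempty, and the empty family is the
   only partition of the empty set, hence the value 1 at n = k = 0. *)
Definition assoc_stirling2 (n k : nat) : nat :=
  #|[pred P : {set {set 'I_n}} |
      [&& finset.partition P [set: 'I_n]%SET,
          #|P| == k & [forall B in P, (2 <= #|B|)%N]]]|.

(* d is the array of unsigned associated Stirling numbers of the first kind,
   i.e. d m k = 0 for m < 2 k and, for v in a neighbourhood of 0,
     (ln (1 + v) - v)^k = k! \sum_(m >= 2k) (-1)^(m+k) d m k v^m / m!.
   By uniqueness of power series expansions this determines d. *)
Definition is_assoc_stirling1 (R : realType) (d : nat -> nat -> R) : Prop :=
  (forall m k : nat, (m < 2 * k)%N -> d m k = 0) /\
  (forall k : nat, \forall v \near (0 : R),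
    (fun N : nat => k`!%:R *
       \sum_(2 * k <= m < N) (-1) ^+ (m + k) * d m k * (v ^+ m / m`!%:R))
    @ \oo --> (ln (1 + v) - v) ^+ k).

(* Second-order Eulerian numbers; the entries with k < 0 are 0.  In the
   recurrence, written for row n.+1, the factor 2 (n+1) - 1 - k equals
   2 n + 1 - k; where the subtraction truncates (k > 2 n + 1), the number
   that it multiplies is 0. *)
Fixpoint eulerian2 (n k : nat) : nat :=
  match n, k with
  | 0, 0 => 1
  | 0, _.+1 => 0
  | n'.+1, 0 => eulerian2 n' 0
  | n'.+1, k'.+1 =>
      k.+1 * eulerian2 n' k + (2 * n' + 1 - k) * eulerian2 n' k'
  end%N.

(* Main.v *)
Require Import Defs.
From mathcomp Require Import all_boot all_order all_algebra ring zify.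

Set Implicit Arguments.
Unset Strict Implicit.
Unset Printing Implicit Defensive.

Import Order.TTheory GRing.Theory Num.Theory.

Local Open Scope ring_scope.

(** The two sides of each identity are equal as rational functions of [w], with
[-1] as only pole.  Put [u = 1 / (1 + w)], so that [- w * u = u - 1].  With
[N = n - 1], the left side of the first identity is the value at [u] of the
polynomial

  [P_N = \sum_k <<N, k>> (X - 1)^k X^(N - k)],

and the second-order Eulerian recurrence says exactly that
[P_(N+1) = ((N + 1) X - N) P_N + X (X - 1) P_N'] ([eulerian2_poly_rec]).

The recurrence [d (m + 1, k) = m (d (m, k) + d (m - 1, k - 1))] says that
[\sum_k (-1)^(N + k) d (N + k, k) X^k] obeys the same first-order recursion, and
both sequences start at [1]; this is the first identity
([eulerian2_stirling1]).  The recurrence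
[S (m + 1, k) = k S (m, k) + m S (m - 1, k - 1)] of the 2-associated subset
numbers says that [Q_N = \sum_k S (N + k, k) (X - 1)^k] satisfies
[Q_(N+1) = (N + 1) (X - 1) Q_N + X (X - 1) Q_N'], and [X Q_N = (X - 1) P_N]
follows for [N >= 1] by induction ([eulerian2_ward]).  Evaluated at [u], where
[u - 1 = - w * u], this is the second identity; the third one combines the first
two.

The two recurrences have to be extracted from the definitions.  For the subset
numbers both [S (m + 1, k + 1)] and [(k + 1) S (m, k + 1)] are sums over blocks
[C] of the number of ways to partition what remains, and their difference is the
part of the first sum where the block is a pair ([partitions2_rec]).  For [d],
the functions [g_k = (ln (1 + v) - v)^k / k!] satisfy
[g_(k+1)' = - v / (1 + v) * g_k], and comparing asymptotic expansions at [0+]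
turns this into a recurrence between their coefficients
([right_expansion_ode]); the expansion of a primitive is controlled by the mean
value theorem, so no power series is differentiated term by term. *)

(** * Triangular recurrences and first-order differential operators *)

Definition diff_op (R : comNzRingType) (A B f : {poly R}) := A * f + B * f^`().

Lemma diff_op_sum (R : comNzRingType) (A B : {poly R}) n (a : nat -> R)
    (c : nat -> {poly R}) :
  diff_op A B (\sum_(k < n) a k *: c k) = \sum_(k < n) a k *: diff_op A B (c k).
Proof.
rewrite /diff_op raddf_sum !mulr_sumr -big_split; apply: eq_bigr => k _ /=.
by rewrite derivZ -!scalerAr scalerDr.
Qed.

(** A two-term recurrence on the coefficients [a -> b] is the same thing as the
action of a first-order operator on the generating polynomials, provided the
operator maps each basis element [c k] to a combination of [c' k] and
[c' k.+1] with the weights of the recurrence. *)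
Lemma diff_op_triangle (R : comNzRingType) (A B : {poly R}) n
    (a b alpha beta : nat -> R) (c c' : nat -> {poly R}) :
  (forall k, (n < k)%N -> a k = 0) ->
  b 0%N = alpha 0%N * a 0%N ->
  (forall k, b k.+1 = alpha k.+1 * a k.+1 + beta k * a k) ->
  (forall k, (k <= n)%N -> diff_op A B (c k) = alpha k *: c' k + beta k *: c' k.+1) ->
  diff_op A B (\sum_(k < n.+1) a k *: c k) = \sum_(k < n.+2) b k *: c' k.
Proof.
move=> a0 b0 bS Hc; rewrite diff_op_sum.
rewrite (eq_bigr (fun k : 'I__ =>
    (alpha k * a k) *: c' k + (beta k * a k) *: c' k.+1)); last first.
  move=> k _; rewrite Hc; last by rewrite -ltnS.
  by rewrite scalerDr !scalerA (mulrC (alpha k)) (mulrC (beta k)).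
rewrite [RHS]big_ord_recl b0 big_split /= big_ord_recl -addrA; congr (_ + _).
rewrite [RHS](eq_bigr (fun k : 'I_n.+1 => (alpha k.+1 * a k.+1) *: c' k.+1
    + (beta k * a k) *: c' k.+1)); last by move=> k _ /=; rewrite -scalerDl -bS.
rewrite [RHS]big_split /= [in RHS]big_ord_recr /=.
by rewrite (a0 n.+1)// mulr0 scale0r addr0.
Qed.

Lemma scale_natpoly (R : comNzRingType) n (p : {poly R}) : n%:R *: p = n%:R * p.
Proof. by rewrite scaler_nat mulr_natl. Qed.

Lemma eulerian2_gt n k : (n < k)%N -> eulerian2 n k = 0%N.
Proof.
elim: n k => [|n IH] [|k] //= nk.
by rewrite !IH ?muln0// ltnW.
Qed.

Section Polynomials.
Variable R : comNzRingType.
Implicit Type n : nat.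

(** The homogenization of the second-order Eulerian polynomial, taken at
[('X - 1, 'X)]. *)
Definition eulerian2_poly n : {poly R} :=
  \sum_(k < n.+1) (eulerian2 n k)%:R *: (('X - 1) ^+ k * 'X ^+ (n - k)).

Lemma diff_op_monomial a b j n :
  'X * ('X - 1) * (('X - 1) ^+ j * 'X ^+ n)^`()
    + (b * 'X + a * ('X - 1)) * (('X - 1) ^+ j * 'X ^+ n)
  = (j%:R + b) * (('X - 1) ^+ j * 'X ^+ n.+1)
    + (n%:R + a) * (('X - 1) ^+ j.+1 * 'X ^+ n) :> {poly R}.
Proof.
rewrite derivM !deriv_exp derivB derivX derivC !subr0.
case: j n => [|j] [|n] /=; rewrite ?exprS ?expr0; ring.
Qed.

Definition eulerian2_op n : {poly R} -> {poly R} :=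
  diff_op (n.+1%:R * 'X - n%:R) ('X * ('X - 1)).

(** Writing the multiplier [(n + 1) X - n] as [X + n (X - 1)], each summand
[(X - 1)^k X^(n - k)] is sent to [k + 1] times the [k]-th summand and
[(n - k) + n] times the [(k + 1)]-th summand of the next row: the weights of the
Eulerian recurrence. *)
Lemma eulerian2_poly_rec n :
  eulerian2_poly n.+1 = eulerian2_op n (eulerian2_poly n).
Proof.
symmetry; apply: (@diff_op_triangle _ _ _ _ (fun k => (eulerian2 n k)%:R)
   (fun k => (eulerian2 n.+1 k)%:R) (fun k => k.+1%:R) (fun k => (2 * n - k)%:R)
   (fun k => ('X - 1) ^+ k * 'X ^+ (n - k))
   (fun k => ('X - 1) ^+ k * 'X ^+ (n.+1 - k))).
- by move=> k nk; rewrite eulerian2_gt.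
- by rewrite mul1r.
- move=> k; rewrite -!natrM -natrD /=; do 2 f_equal.
  by rewrite addnS /= addn0; congr (_ * _)%N; lia.
move=> k kn; rewrite !scale_natpoly.
have -> : (n.+1%:R * 'X - n%:R) = 1 * 'X + n%:R * ('X - 1) :> {poly R} by ring.
rewrite /diff_op addrC diff_op_monomial subSS subSn //.
by rewrite natr1 -!natrD (_ : n - k + n = 2 * n - k)%N //; lia.
Qed.

Definition stirling1_poly (D : nat -> nat -> R) n : {poly R} :=
  \sum_(k < n.+1) D n k *: ((-1) ^+ (n + k) * 'X ^+ k).

(** [eulerian2_op n] sends [X^k] to [(n + k + 1) X^(k + 1) - (n + k) X^k], so
both families are generated from [1] by the same operators. *)
Lemma eulerian2_stirling1 (D : nat -> nat -> R) :
  D 0%N 0%N = 1 ->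
  (forall n k, (n < k)%N -> D n k = 0) ->
  (forall n, D n.+1 0%N = n%:R * D n 0%N) ->
  (forall n k, D n.+1 k.+1 = (n + k.+1)%:R * (D n k.+1 + D n k)) ->
  forall n, eulerian2_poly n = stirling1_poly D n.
Proof.
move=> D00 Dgt Dn0 DS; elim=> [|n IH].
  by rewrite /eulerian2_poly /stirling1_poly !big_ord1 D00.
rewrite eulerian2_poly_rec IH.
apply: (@diff_op_triangle _ _ _ _ (D n) (D n.+1)
   (fun k => (n + k)%:R) (fun k => (n + k.+1)%:R)
   (fun k => (-1) ^+ (n + k) * 'X ^+ k)
   (fun k => (-1) ^+ (n.+1 + k) * 'X ^+ k)).
- exact: Dgt.
- by rewrite addn0.
- by move=> k; rewrite DS mulrDr.
move=> k kn; rewrite !scale_natpoly /diff_op derivM.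
have -> : ((-1) ^+ (n + k))^`() = 0 :> {poly R}.
  rewrite -signr_odd; case: (odd _); rewrite /= ?expr0 ?expr1 ?derivN.
    by rewrite derivC oppr0.
  by rewrite derivC.
rewrite !addSn !addnS derivXn mul0r add0r -[_ *+ k]mulr_natl !exprS.
rewrite -!natr1 !natrD; set s := (-1) ^+ _; move: s => s.
case: k kn => [|k] _ /=; rewrite ?exprS; ring.
Qed.

(** For [W n k] the number of partitions of [n + k] points into [k] blocks of
size at least 2, the entries are the Ward numbers. *)
Definition ward_poly (W : nat -> nat -> nat) n : {poly R} :=
  \sum_(k < n.+1) (W n k)%:R *: ('X - 1) ^+ k.

(** At [n = 0] the relation fails, both polynomials being [1]; the induction
starts at [1], where they are ['X - 1] and ['X]. *)
Lemma eulerian2_ward (W : nat -> nat -> nat) :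
  W 0%N 0%N = 1%N ->
  (forall n k, (n < k)%N -> W n k = 0%N) ->
  (forall n, W n.+1 0%N = 0%N) ->
  (forall n k, W n.+1 k.+1 = k.+1 * W n k.+1 + (n + k.+1) * W n k)%N ->
  forall n, 'X * ward_poly W n.+1 = ('X - 1) * eulerian2_poly n.+1.
Proof.
move=> W00 Wgt Wn0 WS.
have rec n : ward_poly W n.+1 =
    diff_op (n.+1%:R * ('X - 1)) ('X * ('X - 1)) (ward_poly W n).
  symmetry; apply: (@diff_op_triangle _ _ _ _ (fun k => (W n k)%:R)
    (fun k => (W n.+1 k)%:R) (fun k => k%:R) (fun k => (n + k.+1)%:R)
    (fun k => ('X - 1) ^+ k) (fun k => ('X - 1) ^+ k)).
  - by move=> k nk; rewrite Wgt.
  - by rewrite Wn0 mul0r.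
  - by move=> k; rewrite WS natrD !natrM.
  move=> k kn; rewrite !scale_natpoly /diff_op addrC.
  have := diff_op_monomial n.+1%:R 0 k 0; rewrite !expr0 !mulr1 => E.
  move: E; rewrite mul0r add0r => ->; rewrite !exprS; ring.
elim=> [|n IH].
  rewrite rec eulerian2_poly_rec /ward_poly /eulerian2_poly !big_ord1 W00 /=.
  rewrite /eulerian2_op /diff_op !scale1r !expr0 mulr1 derivC; ring.
rewrite rec eulerian2_poly_rec.
move: IH; set Q := ward_poly W _; set P := eulerian2_poly _ => E.
(* Differentiating the induction hypothesis gives Q + X Q', so the left side is
   first written with X Q and Q + X Q' only. *)
have := congr1 (fun p : {poly R} => p^`()) E.
rewrite !derivM derivB derivX derivC subr0 !mul1r => E'.
rewrite /eulerian2_op /diff_op.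
transitivity (('X - 1) *
    ('X * (Q + 'X * Q^`()) - 'X * Q + n.+2%:R * ('X * Q))); first by ring.
by rewrite E' E; ring.
Qed.
End Polynomials.

Local Close Scope ring_scope.

(** * Partitions into blocks of size at least two *)

(** Partitions of an arbitrary subset, so that blocks can be removed without
relabelling the remaining points. *)
Definition partitions2 (T : finType) (A : {set T}) (k : nat) :
    {set {set {set T}}} :=
  [set P | [&& partition P A, #|P| == k & [forall B in P, 1 < #|B|]]].

Section Partitions2.
Variable T : finType.
Implicit Types (A B C D : {set T}) (P : {set {set T}}) (k : nat).

Lemma partitions2P P D k :
  reflect [/\ partition P D, #|P| = k & {in P, forall B, 1 < #|B|}]
  (P \in partitions2 D k).
Proof.
rewrite inE; apply: (iffP and3P) => -[pP /eqP cP].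
  by move/forall_inP.
by move=> H; split=> //; exact/forall_inP.
Qed.

Lemma partitions2_0 D : #|partitions2 D 0| = (D == set0).
Proof.
case: eqVneq => [->|D0].
  apply/eqP/cards1P; exists set0; apply/setP => P.
  apply/idP/set1P => [/partitions2P[_ /cards0_eq]//|->]; apply/partitions2P.
  by rewrite partition_set0 eqxx cards0; split=> // B; rewrite inE.
apply/eqP; rewrite cards_eq0; apply: contraNT D0.
case/set0Pn => P /partitions2P[pP /cards0_eq P0 _].
by rewrite -(cover_partition pP) P0 /cover big_set0.
Qed.

Lemma partitions2_small D k : #|D| < 2 * k -> #|partitions2 D k| = 0.
Proof.
move=> Dk; apply/eqP; rewrite cards_eq0; apply: contraLR Dk.
case/set0Pn => P /partitions2P[pP cP P2].
by rewrite (card_partition pP) -leqNgt mulnC -cP -sum_nat_const leq_sum.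
Qed.

(** Deleting the block [C] is a bijection, with inverse adding it back. *)
Lemma partitions2_block D C k : C \subset D -> 1 < #|C| ->
  #|[set P in partitions2 D k.+1 | C \in P]| = #|partitions2 (D :\: C) k|.
Proof.
move=> CD C2; have C0 : C != set0 by rewrite -card_gt0 ltnW.
have nC P : P \in partitions2 (D :\: C) k -> C \notin P.
  case/partitions2P => pP _ _; apply/negP => CP; case/negP: C0.
  have: C \subset D :\: C by rewrite -(cover_partition pP) (bigcup_max C).
  by rewrite subsetD -setI_eq0 setIid => /andP[].
rewrite -(card_in_imset (f := fun P => C |: P) (D := partitions2 _ _)); last first.
  by move=> P Q /nC CP /nC CQ PQ; rewrite -(setU1K CP) PQ setU1K.
congr #|pred_of_set _|; apply/setP => P; rewrite [LHS]in_set.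
apply/andP/imsetP => [[/partitions2P[pP cP P2] CP]|[Q Qp ->]].
  exists (P :\ C); last by rewrite setD1K.
  apply/partitions2P; split; first exact: partitionD1.
    by move: cP; rewrite (cardsD1 C P) CP => -[].
  by move=> B /setD1P[_]; exact: P2.
rewrite setU11; split=> //; have CQ := nC _ Qp; case/partitions2P: Qp => pQ cQ Q2.
apply/partitions2P; split.
- have -> : D = C :|: (D :\: C) by rewrite -{1}(setIidPr CD) setID.
  by apply: partitionU1 => //; rewrite -setI_eq0 setIDA setIC setDIl setDv setI0.
- by rewrite cardsU1 CQ cQ.
by move=> B /setU1P[->|/Q2].
Qed.

(** Both sides count the partitions with a distinguished block [C]. *)
Lemma partitions2_blocks D k :
  k.+1 * #|partitions2 D k.+1| =
  \sum_(C : {set T} | (C \subset D) && (1 < #|C|)) #|partitions2 (D :\: C) k|.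
Proof.
rewrite (eq_bigr (fun C => \sum_(P in partitions2 D k.+1 | C \in P) 1)); last first.
  move=> C /andP[CD C2]; rewrite -partitions2_block// -sum1_card.
  by apply: eq_bigl => P; rewrite inE.
rewrite (exchange_big_dep (mem (partitions2 D k.+1))) /=; last first.
  by move=> C P _ /andP[].
rewrite mulnC -sum_nat_const; apply: eq_bigr => P PD.
have /partitions2P[pP cP P2] := PD.
rewrite -[LHS]cP -sum1_card; apply: eq_bigl => C; rewrite PD /= andb_idl// => CP.
by rewrite P2// andbT -(cover_partition pP) (bigcup_max C).
Qed.

(** Every partition has exactly one block containing [x]. *)
Lemma partitions2_block_of D k x : x \in D ->
  #|partitions2 D k.+1| =
  \sum_(C : {set T} | [&& C \subset D, 1 < #|C| & x \in C])
    #|partitions2 (D :\: C) k|.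
Proof.
move=> xD.
rewrite (eq_bigr (fun C => \sum_(P in partitions2 D k.+1 | C \in P) 1)); last first.
  move=> C /and3P[CD C2 _]; rewrite -partitions2_block// -sum1_card.
  by apply: eq_bigl => P; rewrite inE.
rewrite (exchange_big_dep (mem (partitions2 D k.+1))) /=; last first.
  by move=> C P _ /andP[].
rewrite -sum1_card; apply: eq_bigr => P PD.
have /partitions2P[pP _ P2] := PD.
have xP : x \in cover P by rewrite (cover_partition pP).
rewrite (big_pred1 (pblock P x))// => C; rewrite PD /=.
apply/andP/eqP => [[/and3P[_ _ xC] CP]|->].
  by rewrite (def_pblock _ CP)//; case/and3P: pP.
rewrite mem_pblock xP pblock_mem// P2 ?pblock_mem// andbT; split=> //.
by rewrite -(cover_partition pP) (bigcup_max (pblock P x)) ?pblock_mem.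
Qed.

(** Expand the left side along the block [x |: C] of [x]: here [C] is any
nonempty subset of [A].  The sets [C] with at least two points give the first
term on the right, by [partitions2_blocks], and the singletons the second. *)
Lemma partitions2_rec A x k : x \notin A ->
  #|partitions2 (x |: A) k.+1| =
  k.+1 * #|partitions2 A k.+1| + \sum_(y in A) #|partitions2 (A :\ y) k|.
Proof.
move=> xA; rewrite (@partitions2_block_of _ _ x) ?setU11// partitions2_blocks.
rewrite (reindex_onto (fun C => x |: C) (fun C => C :\ x)) /=; last first.
  by move=> C /and3P[_ _ xC]; rewrite setD1K.
rewrite (eq_bigl (fun C => (C \subset A) && (0 < #|C|))); last first.
  move=> C; have [xC|xC] := boolP (x \in C).
    have -> : (C \subset A) = false by apply: contraNF xA => /subsetP/(_ _ xC).
    apply/negbTE/negP => /andP[_ /eqP E]; have : x \in (x |: C) :\ x by rewrite E.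
    by rewrite !inE eqxx.
  rewrite setU1K// eqxx andbT setU11 andbT cardsU1 xC add1n ltnS; congr (_ && _).
  apply/subsetP/subsetP => H y yC.
    have := H y; rewrite !inE yC orbT => /(_ isT)/orP[/eqP yx|//].
    by rewrite -yx yC in xC.
  by move: yC; rewrite !inE => /orP[->//|/H ->]; rewrite orbT.
rewrite (bigID (fun C => 1 < #|C|)) /=; congr (_ + _).
  apply: eq_big => C; first by case: (#|C|) => [|[|?]]; rewrite ?andbF ?andbT.
  case/andP => /andP[CA _] C2; congr #|pred_of_set (partitions2 _ _)|.
  apply/setP => y; rewrite !inE; case: (eqVneq y x) => //= ->.
  by rewrite (negPf xA) !andbF.
pose f y : {set T} := [set y].
have -> : \sum_(y in A) #|partitions2 (A :\ y) k| =
    \sum_(C in f @: A) #|partitions2 (A :\: C) k|.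
  by rewrite big_imset //= => y z _ _; exact: set1_inj.
apply: eq_big => C.
  apply/idP/imsetP => [/andP[/andP[CA C0]]|[y yA ->]]; last first.
    by rewrite cards1 sub1set yA.
  rewrite -leqNgt => C1; have /cards1P[y Cy] : #|C| == 1 by rewrite eqn_leq C1.
  by exists y => //; rewrite -sub1set -Cy.
move=> _; congr #|pred_of_set (partitions2 _ _)|.
apply/setP => y; rewrite !inE; case: (eqVneq _ x) => //= ->.
by rewrite (negPf xA) !andbF.
Qed.
End Partitions2.

(** The recurrence determines these numbers from the cardinality alone, by
induction on it. *)
Lemma card_partitions2 (T U : finType) (A : {set T}) (B : {set U}) k :
  #|A| = #|B| -> #|partitions2 A k| = #|partitions2 B k|.
Proof.
have [m] := ubnP #|A|; elim: m => // m IH in A B k *; rewrite ltnS => Am AB.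
case: k => [|k]; first by rewrite !partitions2_0 -!cards_eq0 AB.
have [A0|[x xA]] := set_0Vmem A.
  by rewrite !partitions2_small// -?AB A0 cards0.
have [B0|[y yB]] := set_0Vmem B.
  have: #|A| == 0 by rewrite AB B0 cards0.
  by rewrite cards_eq0 => /eqP A0; rewrite A0 inE in xA.
rewrite -(setD1K xA) -(setD1K yB) !partitions2_rec ?setD11//.
have cA : #|A :\ x|.+1 = #|A| by rewrite (cardsD1 x A) xA.
have cB : #|B :\ y|.+1 = #|B| by rewrite (cardsD1 y B) yB.
have cAB : #|A :\ x| = #|B :\ y| by apply: succn_inj; rewrite cA cB.
rewrite (IH _ (B :\ y))// ?cA//; congr (_ + _).
have [E|[z zA]] := set_0Vmem (A :\ x).
  by have := cAB; rewrite E cards0 => /esym/cards0_eq ->; rewrite !big_set0.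
have [E|[t tB]] := set_0Vmem (B :\ y).
  by have := cAB; rewrite E cards0 => /cards0_eq E'; rewrite E' inE in zA.
have red (V : finType) (C : {set V}) s : s \in C -> #|C :\ s|.+1 = #|C|.
  by move=> sC; rewrite (cardsD1 s C) sC.
have key s s' : s \in A :\ x -> s' \in B :\ y ->
    #|partitions2 (A :\ x :\ s) k| = #|partitions2 (B :\ y :\ s') k|.
  move=> sA sB; have := red _ _ _ sA; have := red _ _ _ sB => E1 E2.
  by apply: IH; lia.
rewrite (eq_bigr (fun=> #|partitions2 (B :\ y :\ t) k|)) => [|s sA]; last exact: key.
rewrite [RHS](eq_bigr (fun=> #|partitions2 (B :\ y :\ t) k|)) => [|s sB].
  by rewrite !sum_nat_const cAB.
by rewrite -(key z s)// -(key z t).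
Qed.

Lemma assoc_stirling2E n k : assoc_stirling2 n k = #|partitions2 [set: 'I_n] k|.
Proof. by rewrite /partitions2 cardsE. Qed.

Lemma assoc_stirling2_rec m k :
  assoc_stirling2 m.+2 k.+1 =
  k.+1 * assoc_stirling2 m.+1 k.+1 + m.+1 * assoc_stirling2 m k.
Proof.
have E n (T : finType) (A : {set T}) j :
    #|A| = n -> #|partitions2 A j| = assoc_stirling2 n j.
  move=> An; rewrite assoc_stirling2E; apply: card_partitions2.
  by rewrite cardsT card_ord.
have cA : #|[set~ ord0 : 'I_m.+2]| = m.+1 by rewrite cardsC1 card_ord.
rewrite assoc_stirling2E -(setD1K (in_setT ord0)) partitions2_rec ?setD11 // setTD.
rewrite (E _ _ _ _ cA) (eq_bigr (fun=> assoc_stirling2 m k)).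
  by rewrite sum_nat_const cA.
move=> y yA; apply: E; have := cA.
by rewrite (cardsD1 y [set~ ord0]) yA => -[].
Qed.

(** * Asymptotic expansions at the right of zero *)

From mathcomp Require Import all_classical all_reals all_analysis lra.

Import numFieldNormedType.Exports.

Local Open Scope classical_set_scope.
Local Open Scope ring_scope.

Section RightExpansion.
Variable R : realType.
Implicit Types (f g df : R -> R) (p q : {poly R}) (M N : nat).

(** [f v = O(v^M)] as [v] tends to [0] from the right; one side is enough to
determine the coefficients of an expansion, and there [v ^+ M] is positive. *)
Definition right_bigO M f := exists C, \forall v \near 0^'+, `|f v| <= C * v ^+ M.

Lemma right_bigO_ext M f g :
  right_bigO M f -> (forall v, 0 < v -> f v = g v) -> right_bigO M g.
Proof.
move=> [C HC] fg; exists C; near=> v.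
rewrite -fg; last by near: v; exact: nbhs_right_gt.
by near: v.
Unshelve. all: by end_near. Qed.

Lemma right_bigOD M f g : right_bigO M f -> right_bigO M g -> right_bigO M (f \+ g).
Proof.
move=> [C HC] [D HD]; exists (C + D); near=> v.
by rewrite mulrDl (le_trans (ler_normD _ _))// lerD//; near: v.
Unshelve. all: by end_near. Qed.

Lemma right_bigON M f : right_bigO M f -> right_bigO M (\- f).
Proof. by move=> [C HC]; exists C; near=> v; rewrite normrN; near: v.
Unshelve. all: by end_near. Qed.

Lemma right_bigOM M N f g :
  right_bigO M f -> right_bigO N g -> right_bigO (M + N) (f \* g).
Proof.
move=> [C HC] [D HD]; exists (C * D); near=> v.
by rewrite normrM exprD mulrACA ler_pM//; near: v.
Unshelve. all: by end_near. Qed.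

Lemma right_bigO_expr M : right_bigO M (fun v => v ^+ M).
Proof.
exists 1; near=> v; have v0 : 0 <= v by near: v; exact: nbhs_right_ge.
by rewrite mul1r ger0_norm// exprn_ge0.
Unshelve. all: by end_near. Qed.

Lemma right_bigO_horner p : right_bigO 0 (horner p).
Proof.
exists (`|p.[0]| + 1); near=> v; rewrite expr0 mulr1.
have : `|p.[0] - p.[v]| < 1.
  near: v; have : horner p v @[v --> 0^'+] --> p.[0].
    by apply: cvg_at_right_filter; exact: continuous_horner.
  by move/cvgrPdist_lt; apply.
move=> h; have := ler_normB p.[0] (p.[0] - p.[v]); rewrite opprB addrC subrK; lra.
Unshelve. all: by end_near. Qed.

(** A polynomial that is [O(v^(M + 1))] vanishes at [0] by continuity, hence is
['X] times a polynomial that is [O(v^M)]. *)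
Lemma right_bigO_coef0 M p i : right_bigO M (horner p) -> (i < M)%N -> p`_i = 0.
Proof.
elim: M p i => // M IH p i [C HC] iM.
have p0 : p.[0] = 0.
  apply/eqP; rewrite -normr_le0.
  have -> : (`|p.[0]| <= 0) = (`|p.[0]| <= (C *: 'X ^+ M.+1).[0]).
    by rewrite hornerZ hornerXn expr0n mulr0.
  apply: (@ler_cvg_to _ (0 : R)^'+ _ _ (fun v => `|p.[v]|)
    (horner (C *: 'X ^+ M.+1))).
  - by apply: cvg_norm; apply: cvg_at_right_filter; exact: continuous_horner.
  - by apply: cvg_at_right_filter; exact: continuous_horner.
  by near=> v; rewrite hornerZ hornerXn; near: v.
have /factor_theorem[q pq] : root p 0 by rewrite /root p0.
rewrite subr0 in pq; case: i iM => [|i] iM; first by rewrite -horner_coef0.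
rewrite pq coefMX /=; apply: IH => //; exists C; near=> v.
have v0 : 0 < v by near: v; exact: nbhs_right_gt.
rewrite -(ler_pM2r v0) -mulrA -exprSr -[X in _ * X](gtr0_norm v0) -normrM.
have -> : q.[v] * v = p.[v] by rewrite pq !hornerE.
by near: v.
Unshelve. all: by end_near. Qed.

(** By the mean value theorem [|f v| = |df c| * v <= |df c|] for some
[0 < c < v], once [v < 1]. *)
Lemma right_bigO_primitive M f df :
  (forall v : R, 0 <= v -> is_derive v 1 f (df v)) -> f 0 = 0 ->
  right_bigO M df -> right_bigO M f.
Proof.
move=> fd f0 [C HC].
have [e e0 He] : exists2 e, 0 < e & forall v, 0 < v < e -> `|df v| <= C * v ^+ M.
  move: HC; rewrite near_withinE => /nbhs_ballP[e /= e0 He].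
  exists e => // v /andP[v0 ve]; apply: He => //.
  by rewrite /ball /= sub0r normrN gtr0_norm.
(* The absolute value makes the bound monotone in v. *)
exists `|C|; near=> v.
have v0 : 0 < v by near: v; exact: nbhs_right_gt.
have ve : v < e by near: v; exact: nbhs_right_lt.
have v1 : v < 1 by near: v; exact: nbhs_right_lt.
have [||c] := @MVT _ f df _ _ v0.
- by move=> x; rewrite in_itv /= => /andP[x0 _]; exact/fd/ltW.
- apply: derivable_within_continuous => x; rewrite in_itv /= => /andP[x0 _].
  by case: (fd x x0).
rewrite in_itv /= => /andP[c0 cv]; rewrite f0 !subr0 => ->.
rewrite normrM (gtr0_norm v0); apply: (@le_trans _ _ (`|df c|)).
  by rewrite ler_piMr// ltW.
apply: (le_trans (He _ _)); first by rewrite c0 (lt_trans cv).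
apply: (@le_trans _ _ (`|C| * c ^+ M)).
  by rewrite ler_wpM2r ?ler_norm// exprn_ge0// ltW.
by rewrite ler_wpM2l// lerXn2r// ?nnegrE ltW.
Unshelve. all: by end_near. Qed.

(** [f] has the asymptotic expansion with coefficients [a] at [0+], to every
order. *)
Definition right_expansion (f : R -> R) (a : nat -> R) :=
  forall M, right_bigO M (fun v => f v - (\poly_(i < M) a i).[v]).

(** Convergence at one radius [r] bounds the terms [a m * r ^+ m], so for
[v <= r / 2] the tail from order [M] on is dominated by a geometric series of
ratio at most [1 / 2]. *)
Lemma series_right_expansion f (a : nat -> R) :
  (\forall v \near 0, series (fun m => a m * v ^+ m) @ \oo --> f v) ->
  right_expansion f a.
Proof.
move=> /nbhs_ballP[e /= e0 He] M.
have {}He v : `|v| < e -> series (fun m => a m * v ^+ m) @ \oo --> f v.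
  by move=> ve; apply: He; rewrite /ball /= sub0r normrN.
pose r := e / 2; have r0 : 0 < r by rewrite divr_gt0.
have re : `|r| < e by rewrite gtr0_norm // /r; lra.
have [B HB] : exists B, forall m, `|a m * r ^+ m| <= B.
  have /cvg_series_bounded : cvgn (series (fun m => a m * r ^+ m)).
    by apply/cvg_ex; exists (f r); exact: He.
  by move=> /pinfty_ex_gt0[B B0 HB]; exists B => m; exact: (HB m).
exists (2 * B / r ^+ M); near=> v.
have v0 : 0 < v by near: v; exact: nbhs_right_gt.
have vr : v < r / 2 by near: v; apply: nbhs_right_lt; rewrite divr_gt0.
have ve : `|v| < e by rewrite gtr0_norm//; rewrite gtr0_norm// in re; lra.
pose t := v / r; have t0 : 0 < t by rewrite divr_gt0.
have t2 : t <= 1 / 2 by rewrite ler_pdivrMr //; lra.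
have vt : v = r * t by rewrite mulrC divfK // gt_eqF.
(* As t <= 1/2, t^m <= 2 (t^m - t^(m+1)): the bound telescopes. *)
have term m : `|a m * v ^+ m| <= 2 * B * (t ^+ m - t ^+ m.+1).
  have tm : 0 <= t ^+ m by rewrite exprn_ge0 ?ltW.
  rewrite vt exprMn mulrA normrM (ger0_norm tm).
  apply: (@le_trans _ _ (B * t ^+ m)); first by rewrite ler_wpM2r.
  have B0 : 0 <= B by exact: le_trans (HB 0%N).
  have : 0 <= B * t ^+ m by rewrite mulr_ge0.
  rewrite exprS; nra.
apply: (@cvgr_to_le _ \oo _ _
    (fun N => `|series (fun m => a m * v ^+ m) N - (\poly_(i < M) a i).[v]|)).
  by apply: cvg_norm; apply: cvgB; [exact: He | exact: cvg_cst].
near=> N; have MN : (M <= N)%N by near: N; exact: nbhs_infty_ge.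
rewrite horner_poly /series /= -(big_mkord xpredT (fun i => a i * v ^+ i)).
rewrite [X in X - _](big_cat_nat (n := M)) //= addrAC subrr add0r.
apply: (le_trans (ler_norm_sum _ _ _)).
apply: (@le_trans _ _ (\sum_(M <= m < N) (2 * B * t ^+ m - 2 * B * t ^+ m.+1))).
  by apply: ler_sum => m _; rewrite -mulrBr.
have := @telescope_sumr R _ _ (fun m => - (2 * B * t ^+ m)) MN.
under eq_bigr do rewrite opprK addrC.
move=> ->; rewrite opprK.
have -> : 2 * B / r ^+ M * v ^+ M = 2 * B * t ^+ M.
  by rewrite vt [(r * t) ^+ M]exprMn [LHS]mulrA divfK // gt_eqF // exprn_gt0.
have B0 : 0 <= B by exact: le_trans (HB 0%N).
have : 0 <= B * t ^+ N by rewrite mulr_ge0// exprn_ge0// ltW.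
lra.
Unshelve. all: by end_near. Qed.

Lemma antiderivative_poly p (c : R) :
  exists2 q : {poly R}, q^`() = p & q.[0] = c.
Proof.
exists (\poly_(i < (size p).+1) (p`_i.-1 / i%:R *+ (0 < i)%N) + c%:P); last first.
  by rewrite hornerD hornerC horner_coef0 coef_poly /= add0r.
rewrite derivD derivC addr0; apply/polyP => i; rewrite coef_deriv coef_poly ltnS /=.
case: ltnP => [_|/(nth_default 0)->]; last by rewrite mul0rn.
by rewrite mulr1n -[LHS]mulr_natr divfK// pnatr_eq0.
Qed.

(** This is the coefficient form of [(1 + v) f' = - v g].  Replacing [g] by its
truncation and [1 / (1 + v)] by the geometric polynomial [s] changes [f'] by
[O(v^M)]; the primitive [q] of the resulting polynomial therefore agrees with [f]
up to [O(v^M)], and its coefficients of degree below [M] are those of [f]. *)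
Lemma right_expansion_ode f g (a b : nat -> R) :
  (forall v : R, -1 < v -> is_derive v 1 f (- v / (1 + v) * g v)) ->
  right_expansion f a -> right_expansion g b ->
  forall m, m.+2%:R * a m.+2 + m.+1%:R * a m.+1 = - b m.
Proof.
move=> fd fa gb m; have [M Mm] : exists M, (m.+2 < M)%N by exists m.+3.
pose p := \poly_(i < M) b i; pose s := \sum_(i < M) (- 'X) ^+ i : {poly R}.
have hs : (1 + 'X) * s = 1 - (- 'X) ^+ M.
  by have := subrX1 (- 'X : {poly R}) M; rewrite -/s => E; rewrite -opprB E; ring.
have [q qd q0] := antiderivative_poly (- 'X * p * s) (f 0).
have fq : right_bigO M (fun v => f v - q.[v]).
  apply: (@right_bigO_primitive _ _ (fun v => - v / (1 + v) * g v - q^`().[v])).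
  - move=> v v0; have v1 : -1 < v by lra.
    by have := fd v v1 => ?; apply: is_deriveB.
  - by rewrite q0 subrr.
  have h1 : right_bigO 0 (fun v => (1 + v)^-1).
    exists 1; near=> v; have v0 : 0 < v by near: v; exact: nbhs_right_gt.
    rewrite expr0 mulr1 ger0_norm; last by rewrite invr_ge0; lra.
    by rewrite invf_le1; lra.
  (* f' - q' = - v (g - p) / (1 + v) - v p (-v)^M / (1 + v) *)
  have h2 := right_bigOM (right_bigOM h1 (right_bigO_horner (- 'X))) (gb M).
  have h3 := right_bigOM (right_bigOM h1
    (right_bigO_horner (- 'X * p * ((-1) ^+ M)%:P))) (right_bigO_expr M).
  apply: right_bigO_ext (right_bigOD h2 h3) _ => v v0 /=; rewrite -/p.
  have v1 : 1 + v != 0 by rewrite gt_eqF//; lra.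
  have sv : (1 + v) * s.[v] = 1 - (-1) ^+ M * v ^+ M.
    have := congr1 (fun r : {poly R} => r.[v]) hs.
    by rewrite /= !hornerE [(- v) ^+ M]exprNn.
  rewrite qd !hornerM !hornerN hornerX hornerC.
  have -> : s.[v] = (1 - (-1) ^+ M * v ^+ M) / (1 + v).
    by rewrite -sv mulrAC divff // mul1r.
  by field.
have pq : right_bigO M (horner (\poly_(i < M) a i - q)).
  apply: right_bigO_ext (right_bigOD fq (right_bigON (fa M))) _ => v _ /=.
  by rewrite hornerD hornerN; ring.
have coefq i : (i < M)%N -> a i = q`_i.
  move=> iM; have := right_bigO_coef0 pq iM.
  by rewrite coefB coef_poly iM => /eqP; rewrite subr_eq0 => /eqP.
have coefq' i : (i.+1 < M)%N -> i.+1%:R * a i.+1 = (- 'X * p * s)`_i.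
  by move=> iM; rewrite coefq// -qd coef_deriv mulr_natl.
rewrite !coefq' //; last exact: ltnW.
have : ((1 + 'X) * (- 'X * p * s))`_m.+1 = - b m.
  rewrite mulrCA hs -mulrA mulNr coefN coefXM /= mulrBr mulr1 coefB exprNn.
  by rewrite mulrA coefMXn (ltnW (ltnW Mm)) subr0 coef_poly (ltnW (ltnW Mm)).
by rewrite mulrDl mul1r coefD coefXM.
Unshelve. all: by end_near. Qed.
End RightExpansion.

(** * Associated Stirling numbers of the first kind *)

Section AssocStirling1.
Variables (R : realType) (d : nat -> nat -> R).
Hypothesis hd : is_assoc_stirling1 d.

Let coef k m : R := (-1) ^+ (m + k) * d m k / m`!%:R.

Lemma assoc_stirling1_expansion k :
  right_expansion (fun v => (ln (1 + v) - v) ^+ k / k`!%:R) (coef k).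
Proof.
apply: series_right_expansion; have [d0 /(_ k)] := hd; apply: filterS => v Hv.
have k0 : k`!%:R != 0 :> R by rewrite pnatr_eq0 -lt0n fact_gt0.
have {}Hv := cvgMl_tmp (a := k`!%:R^-1) Hv.
rewrite [X in _ --> X]mulrC; apply: (cvg_trans _ (Hv _)); apply: near_eq_cvg.
near=> N; rewrite mulKf //.
have kN : (2 * k <= N)%N by near: N; exact: nbhs_infty_ge.
rewrite /series /= [RHS](big_cat_nat (n := 2 * k)) //=.
rewrite [X in _ = X + _]big_nat [X in _ = X + _]big1 ?add0r.
  by apply: eq_bigr => m _; rewrite /coef; ring.
by move=> m /andP[_ mk]; rewrite /coef d0 // mulr0 !mul0r.
Unshelve. all: by end_near. Qed.

(** For [k = 0] the expanded function is the constant [1]. *)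
Lemma assoc_stirling1_0 m : d m 0 = (m == 0%N)%:R.
Proof.
have sm : right_bigO m.+1 (horner (1 - \poly_(i < m.+1) coef 0 i)).
  apply: right_bigO_ext (assoc_stirling1_expansion 0 m.+1) _ => v _ /=.
  by rewrite expr0 fact0 invr1 mulr1 !hornerE.
have := right_bigO_coef0 sm (ltnSn m); rewrite coefB coef1 coef_poly ltnSn /coef addn0.
move/eqP; rewrite subr_eq0 eq_sym => /eqP.
case: m {sm} => [|m] /=; first by rewrite expr0 fact0 invr1 mulr1 mul1r.
move/eqP; rewrite !mulf_eq0 invr_eq0 pnatr_eq0 -[_ == 0%N]negbK -lt0n fact_gt0 orbF.
by rewrite signr_eq0 => /eqP.
Qed.

(** The function [g_k = (ln (1 + v) - v)^k / k!] satisfies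
[g_(k+1)' = (1 / (1 + v) - 1) g_k = - v / (1 + v) * g_k]; the recurrence is the
resulting relation between coefficients, cleared of factorials and signs. *)
Lemma assoc_stirling1_rec m k :
  d m.+2 k.+1 = m.+1%:R * (d m.+1 k.+1 + d m k).
Proof.
have fd (v : R) : -1 < v ->
    is_derive v 1 (fun v => (ln (1 + v) - v) ^+ k.+1 / k.+1`!%:R)
      (- v / (1 + v) * ((ln (1 + v) - v) ^+ k / k`!%:R)).
  move=> v1; have v0 : 0 < 1 + v by lra.
  have dln : is_derive v 1 (fun v => ln (1 + v)) (1 + v)^-1.
    have := @is_derive1_comp _ (@ln R) (fun v => 1 + v) v (1 + v)^-1 1.
    rewrite mulr1; apply; first exact: is_derive1_ln.
    by rewrite -[X in is_derive _ _ _ X]add0r; apply: is_deriveD.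
  have dX := is_deriveX k.+1 (is_deriveB dln (is_derive_id v 1)).
  have k1 : k.+1%:R != 0 :> R by rewrite pnatr_eq0.
  have k0 : k`!%:R != 0 :> R by rewrite pnatr_eq0 -lt0n fact_gt0.
  have dZ := is_deriveZ (k.+1`!%:R^-1) dX.
  have -> : (fun v => (ln (1 + v) - v) ^+ k.+1 / k.+1`!%:R) =
      k.+1`!%:R^-1 \*: ((fun v => ln (1 + v)) - id) ^+ k.+1 :> (R -> R).
    by apply/funext => x; rewrite [LHS]mulrC !fctE.
  apply: is_derive_eq dZ _; rewrite !fctE /= factS natrM /GRing.scale /=.
  have v10 : 1 + v != 0 by rewrite gt_eqF.
  move: (k.+1%:R : R) (k`!%:R : R) k1 k0 => x y x0 y0.
  by field; rewrite x0 y0 v10.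
have := right_expansion_ode fd (assoc_stirling1_expansion k.+1)
  (assoc_stirling1_expansion k) m.
rewrite /coef !factS !natrM.
have m0 : m`!%:R != 0 :> R by rewrite pnatr_eq0 -lt0n fact_gt0.
have m1 : m.+1%:R != 0 :> R by rewrite pnatr_eq0.
have m2 : m.+2%:R != 0 :> R by rewrite pnatr_eq0.
rewrite !addSn !addnS !exprS.
have : (-1) ^+ (m + k) != 0 :> R by rewrite signr_eq0.
move: ((-1) ^+ _) (m`!%:R : R) (m.+1%:R : R) (m.+2%:R : R) m0 m1 m2.
move=> e x x1 x2 x_0 x1_0 x2_0 e0 H.
have -> : d m.+2 k.+1 = - (x1 * x / e) * (x2 *
  (-1 * (-1 * (-1 * e)) * d m.+2 k.+1 / (x2 * (x1 * x))) + x1 *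
  (-1 * (-1 * e) * d m.+1 k.+1 / (x1 * x))) + x1 * d m.+1 k.+1.
  by field; rewrite e0 x_0 x1_0 x2_0.
by rewrite H; field; rewrite e0 x_0.
Qed.
End AssocStirling1.

(** * Evaluation at the Omega constant *)

(** [w = -1] would make [w * expR w] negative; the default value [0] of the
choice operator is not [-1] either. *)
Lemma add1_omega0_neq0 (R : realType) : 1 + omega0 R != 0.
Proof.
rewrite /omega0 /lambertW0; case: xgetP => [w _ [_ we]|_]; last first.
  by rewrite addr0 oner_eq0.
apply/eqP => w1; have w_1 : w = -1 by apply/eqP; rewrite -addr_eq0 addrC w1.
have e0 := expR_gt0 (-1 : R); move: we; rewrite w_1 mulN1r => we; lra.
Qed.

Section Evaluation.
Variables (F : fieldType) (w : F).
Hypothesis w1 : 1 + w != 0.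

Let u := (1 + w)^-1.

Lemma horner_eulerian2_poly n :
  (eulerian2_poly F n).[u] =
  ((1 + w) ^+ n)^-1 *
    \sum_(0 <= k < n.+1) (eulerian2 n k)%:R * (-1) ^+ k * w ^+ k.
Proof.
rewrite big_mkord mulr_sumr horner_sum; apply: eq_bigr => k _.
have uE : u - 1 = - w * u by rewrite /u; field.
rewrite hornerZ hornerM !horner_exp hornerD hornerN hornerX hornerC uE.
have -> : ((1 + w) ^+ n)^-1 = u ^+ k * u ^+ (n - k).
  by rewrite -exprD subnKC -1?ltnS // /u exprVn.
by rewrite exprMn [(- w) ^+ k]exprNn; ring.
Qed.

Lemma horner_stirling1_poly D n :
  (stirling1_poly D n).[u] =
  \sum_(0 <= k < n.+1) (-1) ^+ (n + k) * D n k / (1 + w) ^+ k.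
Proof.
rewrite big_mkord horner_sum; apply: eq_bigr => k _.
rewrite hornerZ hornerM !horner_exp hornerN hornerX hornerC exprVn; ring.
Qed.

Lemma horner_ward_poly W n :
  (ward_poly F W n).[u] =
  \sum_(0 <= k < n.+1) (W n k)%:R * ((-1) ^+ k * w ^+ k / (1 + w) ^+ k).
Proof.
rewrite big_mkord horner_sum; apply: eq_bigr => k _.
have uE : u - 1 = - w * u by rewrite /u; field.
rewrite hornerZ horner_exp hornerD hornerN hornerX hornerC uE exprMn.
by rewrite [(- w) ^+ k]exprNn exprVn.
Qed.
End Evaluation.

(* At n = 1 the last two identities fail: their sides are - omega0 and 1.
   They hold from n = 2 on. *)
Theorem mainTheorem16 (R : realType) (d : nat -> nat -> R)
    (hd : is_assoc_stirling1 d) (n : nat) (hn : (0 < n)%N) :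
  let w := omega0 R in
  [/\ ((1 + w) ^+ (n - 1))^-1 *
        (\sum_(0 <= k < n) (eulerian2 (n - 1) k)%:R * (-1) ^+ k * w ^+ k)
      = \sum_(0 <= k < n)
          (-1) ^+ (n + k - 1) * d (n + k - 1)%N k / (1 + w) ^+ k,
      (1 < n)%N ->
      ((1 + w) ^+ (n - 1))^-1 *
        (\sum_(0 <= k < n)
           (eulerian2 (n - 1) k)%:R * (-1) ^+ k.+1 * w ^+ k.+1)
      = \sum_(0 <= k < n)
          (assoc_stirling2 (n + k - 1) k)%:R
            * ((-1) ^+ k * w ^+ k / (1 + w) ^+ k) &
      (1 < n)%N ->
      w * (\sum_(0 <= k < n)
             (-1) ^+ (n + k) * d (n + k - 1)%N k / (1 + w) ^+ k)
      = \sum_(0 <= k < n)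
          (assoc_stirling2 (n + k - 1) k)%:R
            * ((-1) ^+ k * w ^+ k / (1 + w) ^+ k)].
Proof.
have w1 := add1_omega0_neq0 R; move=> w; rewrite -/w in w1.
case: n hn => // n _; rewrite subn1 /=.
have first_id : (eulerian2_poly R n).[(1 + w)^-1] =
    (stirling1_poly (fun n k => d (n + k)%N k) n).[(1 + w)^-1].
  congr horner; apply: eulerian2_stirling1 => [|m k mk|[|m]|m k].
  - by rewrite (assoc_stirling1_0 hd).
  - by apply: (proj1 hd); rewrite mul2n -addnn ltn_add2r.
  - by rewrite !(assoc_stirling1_0 hd) mul0r.
  - by rewrite !(assoc_stirling1_0 hd) mulr0.
  by rewrite addSn !addnS (assoc_stirling1_rec hd).
have second_id : (1 < n.+1)%N -> - w * (eulerian2_poly R n).[(1 + w)^-1] =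
    (ward_poly R (fun n k => assoc_stirling2 (n + k) k) n).[(1 + w)^-1].
  case: n {first_id} => // n _.
  have W0 m : assoc_stirling2 m 0 = (m == 0%N).
    by rewrite assoc_stirling2E partitions2_0 -cards_eq0 cardsT card_ord.
  have : 'X * ward_poly R (fun n k => assoc_stirling2 (n + k) k) n.+1 =
      ('X - 1) * eulerian2_poly R n.+1.
    apply: eulerian2_ward => [|m k mk|m|m k].
    - by rewrite W0.
    - rewrite assoc_stirling2E partitions2_small // cardsT card_ord.
      by rewrite mul2n -addnn ltn_add2r.
    - by rewrite W0.
    by rewrite addSn !addnS assoc_stirling2_rec.
  move/(congr1 (fun p : {poly R} => (1 + w) * p.[(1 + w)^-1])).
  rewrite !hornerM hornerD hornerN hornerX hornerC mulVKf // => ->.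
  by field.
rewrite horner_eulerian2_poly // in first_id second_id.
rewrite horner_stirling1_poly in first_id.
rewrite horner_ward_poly // in second_id.
split.
- by rewrite first_id; apply: eq_bigr => k _; rewrite addSn subn1.
- move=> n1; transitivity (- w * (((1 + w) ^+ n)^-1 *
    \sum_(0 <= k < n.+1) (eulerian2 n k)%:R * (-1) ^+ k * w ^+ k)).
    rewrite mulrCA; congr (_ * _); rewrite mulr_sumr; apply: eq_bigr => k _.
    by rewrite !exprS; ring.
  by rewrite second_id //; apply: eq_bigr => k _; rewrite addSn subn1.
move=> n1; transitivity (- w * (((1 + w) ^+ n)^-1 *
    \sum_(0 <= k < n.+1) (eulerian2 n k)%:R * (-1) ^+ k * w ^+ k)).
  rewrite first_id mulNr -mulrN; congr (_ * _).
  rewrite raddf_sum; apply: eq_bigr => k _.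
  by rewrite addSn subn1 /= !exprS; ring.
by rewrite second_id //; apply: eq_bigr => k _; rewrite addSn subn1.
Qed.
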